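(* Let $d\ge1$ be an integer and $\alpha\in(0,1)$. There exist constants $C,c>0$ and $N_0\ge1$ and, for every real number $N\ge N_0$, a function $c_N:Q_1\to\mathbb{R}$ and a smooth real-valued stationary solution $u_N$ of $$(\partial_t+v\cdot\nabla_x)u_N=\Delta_vu_N+c_Nu_N\qquad\text{in }Q_1$$ (that is, with zero forcing), such that $$\frac12\le u_N\le\frac32,\qquad \|c_N\|_{L^\infty(Q_1)}\le C,\qquad [c_N]_{C_v^\alpha(Q_1)}\le C N^{(\alpha-2)/3},$$ while $$[D_v^2u_N]_{C_v^\alpha(Q_{1/2})}\ge cN^{\alpha/3}.$$ In particular, since $(\alpha-2)/3<0$, $[c_N]_{C_v^\alpha(Q_1)}\to0$ while $[D_v^2u_N]_{C_v^\alpha(Q_{1/2})}\to\infty$ as $N\to\infty$. Thus the velocity-only Schauder estimate fails even when $g\equiv0$: for every $\Lambda>1$ with $\Lambda\ge C$ there is no constant $C'=C'(d,\alpha,\Lambda)$ such that every smooth solution $f$ in $Q_1$ of $$(\partial_t+v\cdot\nabla_x)f=\operatorname{tr}(a\,D_v^2 f)+b\,f$$ with $\Lambda^{-1}\mathrm{Id}\le a\le\Lambda\,\mathrm{Id}$, $|b|\le\Lambda$ in $Q_1$ and $f,D_v^2f,a,b\in C_v^\alpha(Q_1)$ satisfies $$[D_v^2f]_{C_v^\alpha(Q_{1/2})}\le C'\Big(1+[b]_{C_v^\alpha(Q_1)}+[a]_{C_v^\alpha(Q_1)}^{1+2/\alpha}\Big)\|f\|_{L^\infty(Q_1)}.$$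
   Context: Points are written $(t,x,v)\in\mathbb{R}\times\mathbb{R}^d\times\mathbb{R}^d$. For $r>0$, $B_r\subset\mathbb{R}^d$ is the ball of radius $r$ centered at the origin, and $Q_r=(-r^2,0]\times B_{r^3}\times B_r$. A stationary solution is one that does not depend on $t$. $D_v^2 f$ is the $d\times d$ Hessian matrix of $f$ in $v$, and $\Delta_v$ is the Laplacian in $v$. The coefficient $a$ is $d\times d$ matrix-valued and $b$ is a real-valued function of $(t,x,v)$; the matrix inequalities on $a$ are in the sense of quadratic forms. For a bounded function $h$ on a cylinder $Q$, the velocity Hölder seminorm is $$[h]_{C_v^\alpha(Q)}:=\sup_{\substack{(t,x,v),(t,x,v')\in Q\\ 0<|v-v'|<1/2}}\frac{|h(t,x,v)-h(t,x,v')|}{|v-v'|^\alpha}.$$ For matrix-valued $h$, $|\cdot|$ is the Frobenius norm $|M|=(\sum_{i,j}|M_{ij}|^2)^{1/2}$. $h\in C_v^\alpha(Q)$ means $h$ is bounded on $Q$ with $[h]_{C_v^\alpha(Q)}<\infty$. *)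

(* Defs.v *)
From mathcomp Require Import all_boot all_order all_algebra.
From mathcomp Require Import all_classical all_reals all_analysis.

Set Implicit Arguments.
Unset Strict Implicit.
Unset Printing Implicit Defensive.

Import Order.TTheory GRing.Theory Num.Theory.
Import numFieldNormedType.Exports.

Local Open Scope classical_set_scope.
Local Open Scope ring_scope.

(* A point (t, x, v) is the triple p with t = p.1.1, x = p.1.2, v = p.2.
   Functions on a subset of this space are represented by total functions. *)
Notation phase R d := (R * 'rV[R]_d * 'rV[R]_d)%type.

(* The library norm on matrices is the max norm, hence this definition; on
   row vectors it is the Euclidean norm. *)
Definition frob (R : realType) (m n : nat) (M : 'M[R]_(m, n)) : R :=
  Num.sqrt (\sum_i \sum_j `|M i j| ^+ 2).

Definition enorm (R : realType) (d : nat) (v : 'rV[R]_d) : R := frob v.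

Definition cylinder (R : realType) (d : nat) (r : R) : set (phase R d) :=
  [set p | [/\ - r ^+ 2 < p.1.1 <= 0, enorm p.1.2 < r ^+ 3 & enorm p.2 < r]].

Definition sup_norm (R : realType) (d : nat) (Q : set (phase R d))
    (h : phase R d -> R) : \bar R :=
  ereal_sup [set `|h p|%:E | p in Q].

Section Holder.
Variables (R : realType) (d : nat) (V : zmodType) (nrm : V -> R).

Definition holder_v_of (alpha : R) (Q : set (phase R d)) (h : phase R d -> V)
    : \bar R :=
  ereal_sup [set y | exists t x v v',
    [/\ Q (t, x, v), Q (t, x, v'), 0 < enorm (v - v') < 1 / 2 &
        y = (nrm (h (t, x, v) - h (t, x, v')) / enorm (v - v') `^ alpha)%:E]].

Definition Cv_of (alpha : R) (Q : set (phase R d)) (h : phase R d -> V) : Prop :=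
  (exists M : R, forall p, Q p -> nrm (h p) <= M) /\
  (holder_v_of alpha Q h < +oo)%E.

End Holder.

Notation holder_v := (holder_v_of Num.norm).
Notation Cv := (Cv_of Num.norm).
Notation holder_v_mx := (holder_v_of (@frob _ _ _)).
Notation Cv_mx := (Cv_of (@frob _ _ _)).

Section Derivatives.
Variables (R : realType) (d : nat).
Implicit Types (f : phase R d -> R) (p : phase R d) (i : 'I_d).

Definition partial_t f p : R := 'D_((1, 0, 0) : phase R d) f p.

Definition partial_x i f p : R :=
  'D_((0, delta_mx 0 i, 0) : phase R d) f p.

Definition partial_v i f p : R :=
  'D_((0, 0, delta_mx 0 i) : phase R d) f p.

Definition transport f p : R :=
  partial_t f p + \sum_(i < d) p.2 0 i * partial_x i f p.

Definition hess_v f p : 'M[R]_d :=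
  \matrix_(i, j) partial_v i (partial_v j f) p.

Definition laplace_v f p : R := \sum_(i < d) partial_v i (partial_v i f) p.

Fixpoint iter_derive (s : seq (phase R d)) f : phase R d -> R :=
  if s is e :: s' then (fun p => 'D_e (iter_derive s' f) p) else f.

(* C^oo on an open neighbourhood of Q.  A cylinder is not open at t = 0: this
   is smoothness up to t = 0, where the derivatives of f are determined by its
   values for t <= 0. *)
Definition smooth_on (Q : set (phase R d)) f : Prop :=
  exists U : set (phase R d), [/\ open U, Q `<=` U &
    forall s p, U p -> differentiable (iter_derive s f) p].

Definition stationary_on (Q : set (phase R d)) f : Prop :=
  forall t t' x v, Q (t, x, v) -> Q (t', x, v) -> f (t, x, v) = f (t', x, v).

End Derivatives.

Definition qform_le (R : realType) (d : nat) (A B : 'M[R]_d) : Prop :=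
  forall w : 'rV[R]_d, (w *m A *m w^T) 0 0 <= (w *m B *m w^T) 0 0.

(* Main.v *)
From HB Require Import structures.
Require Import Defs.
From mathcomp Require Import all_boot all_order all_algebra.
From mathcomp Require Import all_classical all_reals all_analysis.
From mathcomp Require Import ring lra.

Import Order.TTheory GRing.Theory Num.Theory.
Import numFieldNormedType.Exports.

Local Open Scope classical_set_scope.
Local Open Scope ring_scope.

Set Implicit Arguments.
Unset Strict Implicit.
Unset Printing Implicit Defensive.

(** The phenomenon is one-dimensional: only the first coordinates of x and v
    enter.  With M = N^(1/3), the function
      u(x, v) = 1 + k M^-2 \int_0^M exp(-s^3/3) cos(M^3 x - M s v) ds
    is a stationary solution of v u_x = u_vv + F, where
      F = k (cos(M^3 x) - exp(-M^3/3) cos(M^3 x - M^2 v)).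
    Indeed the phase is chosen so that v d/dx - d^2/dv^2 turns the integrand
    into an exact s-derivative, and F collects the two end points.  At
    s = 0 the boundary term depends on x only, so it is invisible to the
    velocity seminorm; at s = M it is exponentially small.  This is the Fourier
    representation of the inhomogeneous Airy equation i v W = W'' + 1, truncated
    at s = M so that only integrals over compact intervals occur.

    The frequency in v is M while the amplitude is M^-2, so that u - 1 has
    velocity seminorm of order M^(a-2), and c = F / u inherits this order
    [kolm_coef_holder].  The Hessian gains exactly the factor M^2: it equals
    - k \int_0^M s^2 exp(-s^3/3) cos(M^3 x - M s v) ds in its only nonzero entry,
    and comparing v = 0 with v = 1/(4M) at x = 0 shows an oscillation bounded
    below by a constant at distance 1/(4M), hence a seminorm of order at least
    M^a [hess_kolm_sol_holder_ge].

    Smoothness comes from the closure of the class of oscillatory integrals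
    [osc] under directional derivatives: a derivative multiplies the weight by
    a polynomial in s and shifts the phase by pi/2 [derive_osc].  Finally, a
    Schauder estimate with constant C' applied to a = Id, b = c, f = u would
    bound the seminorm of the Hessian uniformly in N, a contradiction. *)

(** * Integrals of continuous functions over [0, S] *)

Section Integrals.
Variables (R : realType) (S : R).
Implicit Types (f g : R -> R).

Local Notation "\int0 f" :=
  (\int[@lebesgue_measure R]_(s in `[0, S]) f s) (at level 10).

Lemma continuous_integrable_itv f : continuous f ->
  (@lebesgue_measure R).-integrable `[0, S] (EFin \o f).
Proof.
move=> cf; apply: continuous_compact_integrable; first exact: segment_compact.
exact: continuous_subspaceT.
Qed.

Lemma integral_itvD f g : continuous f -> continuous g ->
  \int0 (fun s => f s + g s) = \int0 f + \int0 g.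
Proof. by move=> cf cg; rewrite RintegralD//; apply: continuous_integrable_itv. Qed.

Lemma integral_itvB f g : continuous f -> continuous g ->
  \int0 (fun s => f s - g s) = \int0 f - \int0 g.
Proof. by move=> cf cg; rewrite RintegralB//; apply: continuous_integrable_itv. Qed.

Lemma integral_itvZ c f : continuous f ->
  \int0 (fun s => c * f s) = c * \int0 f.
Proof. by move=> cf; rewrite RintegralZl//; apply: continuous_integrable_itv. Qed.

Lemma le_integral_itv f g : continuous f -> continuous g ->
  (forall s, 0 <= s <= S -> f s <= g s) -> \int0 f <= \int0 g.
Proof.
move=> cf cg fg; apply: le_Rintegral => //;
  exact: continuous_integrable_itv.
Qed.

Lemma normr_integral_itv_le f g : continuous f -> continuous g ->
  (forall s, 0 <= s <= S -> `|f s| <= g s) -> `|\int0 f| <= \int0 g.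
Proof.
move=> cf cg fg; apply: (le_trans (le_normr_Rintegral _ _)) => //.
  exact: continuous_integrable_itv.
apply: le_integral_itv => // s; exact: continuous_comp (cf s) (@norm_continuous _ _ _).
Qed.

Lemma integral_itv_derive f (F : R -> R) : 0 < S -> continuous f ->
  (forall s : R, is_derive s 1 F (f s)) -> \int0 f = F S - F 0.
Proof.
move=> S0 cf dF.
have cF : continuous F.
  by move=> s; apply/differentiable_continuous/derivable1_diffP/ex_derive.
rewrite /Rintegral (@continuous_FTC2 _ f F) //.
- exact: continuous_subspaceT.
- split.
  + by move=> s _; apply: ex_derive.
  + exact: cvg_at_right_filter (cF _).
  + exact: cvg_at_left_filter (cF _).
- by move=> s _; rewrite derive1E; apply: derive_val.
Qed.

End Integrals.

(** * Lipschitz, Taylor and Hoelder bounds for the cosine *)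

Section Lipschitz.
Variable R : realType.

Lemma lipschitz_derive (F F' : R -> R) (L : R) :
  (forall s : R, is_derive s 1 F (F' s)) -> (forall s, `|F' s| <= L) ->
  forall x y, `|F y - F x| <= L * `|y - x|.
Proof.
move=> dF bF x y; wlog xy : x y / x <= y => [H|].
  have [/H//|/ltW/H] := leP x y.
  by rewrite distrC (distrC x).
have [|z _ ->] := @MVT_segment _ F F' x y xy (fun s _ => dF s).
  apply: continuous_subspaceT => s.
  by apply/differentiable_continuous/derivable1_diffP/ex_derive.
by rewrite normrM ler_wpM2r.
Qed.

Lemma cos_lipschitz (x y : R) : `|cos y - cos x| <= `|y - x|.
Proof.
have := @lipschitz_derive cos (fun s => - sin s) 1 _ _ x y.
rewrite mul1r; apply=> s.
by rewrite normrN ler_norml sin_le1 sin_geN1.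
Qed.

Lemma sin_lipschitz (x y : R) : `|sin y - sin x| <= `|y - x|.
Proof.
have := @lipschitz_derive sin cos 1 _ _ x y.
rewrite mul1r; apply=> s.
by rewrite ler_norml cos_le1 cos_geN1.
Qed.

Lemma cos_taylor1 (y h : R) : `|cos (y + h) - cos y + h * sin y| <= h ^+ 2.
Proof.
have H (a b : R) : a <= b -> forall m, m \in `[a, b]%R ->
    `|cos b - cos a + (b - a) * sin m| <= (b - a) ^+ 2.
  move=> ab m; rewrite in_itv/= => /andP[am mb].
  have [|z] := @MVT_segment _ cos (fun s => - sin s) a b ab (fun s _ => is_derive_cos s).
    by apply: continuous_subspaceT; exact: continuous_cos.
  rewrite in_itv/= => /andP[az zb] ->.
  rewrite mulNr mulrC addrC -mulrBr normrM expr2 ger0_norm ?subr_ge0//.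
  rewrite ler_wpM2l ?subr_ge0// (le_trans (sin_lipschitz _ _))// ler_norml.
  lra.
have [h0|h0] := leP 0 h.
  have := H y (y + h) _ y; rewrite in_itv/= lerDl h0 lexx => /(_ _ _)/=.
  by rewrite (addrC y) addrK; apply.
have := H (y + h) y _ y; rewrite in_itv/= lexx gerDl (ltW h0) => /(_ _ _)/=.
rewrite (_ : y - (y + h) = - h); last by ring.
rewrite sqrrN -normrN (_ : - (_ + _) = cos (y + h) - cos y + h * sin y); last by ring.
by apply.
Qed.

Lemma powR_ge_min1 (z a : R) : 0 <= z -> 0 < a <= 1 -> Num.min 1 z <= z `^ a.
Proof.
move=> z0 /andP[a0 a1]; rewrite ge_min.
have [z1|z1] := leP 1 z.
  have := ge0_ler_powR (ltW a0) _ _ z1; rewrite powR1 => -> //.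
  by rewrite nnegrE.
apply/orP; right; move: z0; rewrite le_eqVlt => /predU1P[<-|z0].
  exact: powR_ge0.
by rewrite ger1_powR// z0 ltW.
Qed.

Lemma powR_le1D (s a : R) : 0 <= s -> 0 < a <= 1 -> s `^ a <= 1 + s.
Proof.
move=> s0 /andP[a0 a1]; have [s1|s1] := leP 1 s.
  by rewrite (le_trans (ler1_powR s1 a1))// lerDr.
rewrite (@le_trans _ _ 1) ?lerDl//.
have := ge0_ler_powR (ltW a0) _ _ (ltW s1); rewrite powR1; apply => //.
by rewrite nnegrE.
Qed.

(** Interpolation between the bound 2 and the Lipschitz bound. *)
Lemma cos_holder (x y a : R) : 0 < a <= 1 -> `|cos y - cos x| <= 2 * `|y - x| `^ a.
Proof.
move=> a01; apply: (@le_trans _ _ (2 * Num.min 1 `|y - x|)); last first.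
  by rewrite ler_wpM2l// powR_ge_min1.
have c1 : `|cos y - cos x| <= 2.
  move: (cos_le1 x) (cos_le1 y) (cos_geN1 x) (cos_geN1 y); rewrite ler_norml.
  by move=> *; lra.
have c2 := cos_lipschitz x y.
have := normr_ge0 (y - x).
by case: (leP 1 `|y - x|) => *; lra.
Qed.

End Lipschitz.

(** * Oscillatory integrals in phase space *)

(** A first-order expansion with quadratic remainder yields the differential. *)
Lemma differentiable_taylor (R : realType) (V W : normedModType R) (f : V -> W)
    (df : {linear V -> W}) (p : V) (K L : R) :
  0 <= K -> (forall h, `|df h| <= L * `|h|) ->
  (forall h, `|f (p + h) - f p - df h| <= K * `|h| ^+ 2) ->
  differentiable f p /\ 'd f p = df :> (V -> W).
Proof.
move=> K0 Ldf Kf.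
have K1 : 0 < K + 1 by rewrite ltr_wpDl.
have cdf : continuous df.
  apply: bounded_linear_continuous; apply/linear_boundedP; near=> r => h /=.
  apply: le_trans (Ldf h) _; by rewrite ler_wpM2r.
have fE : f \o shift p = cst (f p) + df +o_ 0 id.
  apply/eqaddoP => _/posnumP[eps]; near=> h.
  rewrite !fctE /= (addrC h) opprD addrA (le_trans (Kf h))//.
  rewrite expr2 mulrA ler_wpM2r// (@le_trans _ _ ((K + 1) * `|h|))//.
    by rewrite ler_wpM2r// lerDl.
  rewrite -ler_pdivlMl//; near: h.
  apply/nbhs_normP; exists ((K + 1)^-1 * eps%:num) => /=.
    by rewrite mulr_gt0 ?invr_gt0.
  by move=> h /=; rewrite sub0r normrN => /ltW.
have dE := diff_unique cdf fE.
split=> //; apply/diff_locallyP; rewrite dE; split => //.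
Unshelve. all: by end_near. Qed.

Section Oscillatory.
Variables (R : realType) (d : nat) (S A B : R).
Hypothesis S0 : 0 <= S.
Implicit Types (p e h : phase R d.+1) (rho : R -> R).

(** The linear phase A x - B s v, in the first coordinates of x and v. *)
Definition osc_phase (s : R) p : R := A * p.1.2 0 0 - B * s * p.2 0 0.

(** Constant plus oscillatory integral with weight [rho] and phase shift [th].
    The shift encodes both cosines and sines, so that derivatives stay in the
    class. *)
Definition osc (k th : R) (rho : R -> R) p : R :=
  k + \int[@lebesgue_measure R]_(s in `[0, S]) (rho s * cos (th + osc_phase s p)).

Lemma osc_phaseD s p h : osc_phase s (p + h) = osc_phase s p + osc_phase s h.
Proof. by rewrite /osc_phase /= !mxE; ring. Qed.

Lemma osc_phaseZ s (a : R) h : osc_phase s (a *: h) = a * osc_phase s h.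
Proof. by rewrite /osc_phase /= !mxE; ring. Qed.

Lemma continuous_osc_phase p : continuous (osc_phase ^~ p).
Proof.
move=> s; apply: cvgB; first exact: cvg_cst.
by apply: cvgM; [apply: cvgM; [exact: cvg_cst|exact: cvg_id]|exact: cvg_cst].
Qed.

Lemma continuous_osc_integrand rho th p : continuous rho ->
  continuous (fun s => rho s * cos (th + osc_phase s p)).
Proof.
move=> cr s; apply: cvgM; first exact: cr.
apply: (@continuous_comp _ _ _ (fun s => th + osc_phase s p) cos); last exact: continuous_cos.
by apply: cvgD; [exact: cvg_cst|exact: continuous_osc_phase].
Qed.

Lemma osc_phase_le s h : 0 <= s <= S ->
  `|osc_phase s h| <= (`|A| + `|B| * S) * `|h|.
Proof.
move=> /andP[s0 sS].
have hx : `|h.1.2 0 0| <= `|h|.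
  apply: (@le_trans _ _ `|h.1.2|); last first.
    by rewrite !prod_normE !le_max lexx ?orbT.
  rewrite [leRHS]/Num.norm/= mx_normrE.
  exact: (le_bigmax _ (fun ij => `|h.1.2 ij.1 ij.2|) (0, 0)).
have hv : `|h.2 0 0| <= `|h|.
  apply: (@le_trans _ _ `|h.2|); last first.
    by rewrite !prod_normE !le_max lexx ?orbT.
  rewrite [leRHS]/Num.norm/= mx_normrE.
  exact: (le_bigmax _ (fun ij => `|h.2 ij.1 ij.2|) (0, 0)).
rewrite mulrDl (le_trans (ler_normB _ _))// lerD//.
  by rewrite normrM ler_wpM2l.
rewrite !normrM (ger0_norm s0) ler_pM ?mulr_ge0//.
by rewrite ler_wpM2l.
Qed.

(** The differential at [p] of the oscillatory integral, in the direction [e]. *)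
Definition osc_diff th rho p e : R :=
  osc 0 (th + pi / 2) (fun s => rho s * osc_phase s e) p.

Lemma osc_diff_linear th rho p : continuous rho -> linear (osc_diff th rho p).
Proof.
move=> cr a h1 h2; rewrite /osc_diff /osc !add0r.
have cph e : continuous (fun s => rho s * osc_phase s e).
  by move=> s; apply: cvgM; [exact: cr|exact: continuous_osc_phase].
have ci e := continuous_osc_integrand (th:=th + pi / 2) (p:=p) (cph e).
have sE (x : R) : a *: x = a * x by [].
rewrite sE -integral_itvZ// -integral_itvD//; last first.
  by move=> s; apply: cvgM; [exact: cvg_cst|exact: ci].
by apply: eq_Rintegral => s _; rewrite osc_phaseD osc_phaseZ; ring.
Qed.

Lemma osc_diff_le th rho p e : continuous rho ->
  `|osc_diff th rho p e| <=
  (\int[@lebesgue_measure R]_(s in `[0, S]) `|rho s|) * (`|A| + `|B| * S) * `|e|.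
Proof.
move=> cr; rewrite /osc_diff /osc add0r -mulrA [leRHS]mulrC.
have cn : continuous (fun s => `|rho s|).
  by move=> s; exact: continuous_comp (cr s) (@norm_continuous _ _ _).
rewrite -integral_itvZ//; apply: normr_integral_itv_le.
- apply: continuous_osc_integrand => s.
  by apply: cvgM; [exact: cr|exact: continuous_osc_phase].
- by move=> s; apply: cvgM; [exact: cvg_cst|exact: cn].
move=> s sS; rewrite !normrM [leRHS]mulrC -mulrA ler_wpM2l//.
rewrite -[leRHS]mulr1 ler_pM// ?osc_phase_le//.
by rewrite ler_norml cos_le1 cos_geN1.
Qed.

Lemma osc_taylor k th rho p h : continuous rho ->
  `|osc k th rho (p + h) - osc k th rho p - osc_diff th rho p h| <=
  (\int[@lebesgue_measure R]_(s in `[0, S]) `|rho s|) *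
  (`|A| + `|B| * S) ^+ 2 * `|h| ^+ 2.
Proof.
move=> cr; rewrite /osc_diff /osc add0r opprD addrACA subrr add0r.
have cn : continuous (fun s => `|rho s|).
  by move=> s; exact: continuous_comp (cr s) (@norm_continuous _ _ _).
have c1 := continuous_osc_integrand (th:=th) (p:=p + h) cr.
have c0 := continuous_osc_integrand (th:=th) (p:=p) cr.
have c2 : continuous (fun s => rho s * osc_phase s h * cos (th + pi / 2 + osc_phase s p)).
  apply: continuous_osc_integrand => s.
  by apply: cvgM; [exact: cr|exact: continuous_osc_phase].
rewrite -integral_itvB// -integral_itvB//; last first.
  by move=> s; apply: cvgB; [exact: c1|exact: c0].
rewrite -mulrA [leRHS]mulrC -integral_itvZ//; apply: normr_integral_itv_le.
- move=> s; apply: cvgB; last exact: c2.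
  by apply: cvgB; [exact: c1|exact: c0].
- by move=> s; apply: cvgM; [exact: cvg_cst|exact: cn].
move=> s sS.
rewrite osc_phaseD (_ : th + pi / 2 + _ = th + osc_phase s p + pi / 2); last by ring.
rewrite cosDpihalf addrA.
set y := th + _; set z := osc_phase s h.
rewrite (_ : _ - _ = rho s * (cos (y + z) - cos y + z * sin y)); last by ring.
rewrite normrM mulrC ler_wpM2r// (le_trans (cos_taylor1 _ _))//.
rewrite -exprMn -[leLHS]ger0_norm ?sqr_ge0// normrX lerXn2r ?nnegrE ?mulr_ge0//.
  by rewrite addr_ge0 ?mulr_ge0.
exact: osc_phase_le.
Qed.

Lemma osc_differentiable k th rho p : continuous rho ->
  differentiable (osc k th rho) p /\ 'd (osc k th rho) p = osc_diff th rho p :> (_ -> _).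
Proof.
move=> cr.
pose dfM := GRing.isLinear.Build _ _ _ _ (osc_diff th rho p) (osc_diff_linear th p cr).
pose df : {linear phase R d.+1 -> R} := HB.pack (osc_diff th rho p) dfM.
apply: (@differentiable_taylor R _ _ (osc k th rho) df p) => [|h|h]; last exact: osc_taylor.
  by rewrite mulr_ge0 ?sqr_ge0// Rintegral_ge0.
exact: osc_diff_le.
Qed.

Lemma derive_osc k th rho p e : continuous rho ->
  'D_e (osc k th rho) p = osc 0 (th + pi / 2) (fun s => rho s * osc_phase s e) p.
Proof.
by move=> cr; have [df dE] := osc_differentiable k th p cr; rewrite deriveE// dE.
Qed.

(** The class of oscillatory integrals is closed under directional
    derivatives, whence smoothness. *)
Lemma iter_derive_osc (s : seq (phase R d.+1)) k th rho : continuous rho ->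
  exists k' th' rho', continuous rho' /\
    iter_derive s (osc k th rho) = osc k' th' rho'.
Proof.
move=> cr; elim: s => [|e s [k' [th' [rho' [cr' IH]]]]] /=.
  by exists k, th, rho.
exists 0, (th' + pi / 2), (fun s => rho' s * osc_phase s e); split.
  by move=> x; apply: cvgM; [exact: cr'|exact: continuous_osc_phase].
by apply/funext => p; rewrite IH derive_osc.
Qed.

Lemma smooth_osc Q k th rho : continuous rho -> smooth_on Q (osc k th rho).
Proof.
move=> cr; exists setT; split => // [|s p _]; first exact: openT.
have [k' [th' [rho' [cr' ->]]]] := iter_derive_osc s k th cr.
by have [] := osc_differentiable k' th' p cr'.
Qed.

End Oscillatory.

(** * Bounds and partial derivatives of oscillatory integrals *)

Section OscillatoryEstimates.
Variables (R : realType) (d : nat) (S A B : R).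
Hypothesis S0 : 0 <= S.
Implicit Types (p e h : phase R d.+1) (rho : R -> R).

Local Notation oscS := (osc S A B).

Lemma osc_le k th rho p : continuous rho ->
  `|oscS k th rho p - k| <= \int[@lebesgue_measure R]_(s in `[0, S]) `|rho s|.
Proof.
move=> cr; rewrite /osc addrC addKr; apply: normr_integral_itv_le.
- exact: continuous_osc_integrand.
- by move=> s; exact: continuous_comp (cr s) (@norm_continuous _ _ _).
by move=> s _; rewrite normrM ler_piMr// ler_norml cos_le1 cos_geN1.
Qed.

Lemma coord_le_enorm (v : 'rV[R]_d.+1) i : `|v 0 i| <= enorm v.
Proof.
rewrite /enorm /frob -[leLHS]ger0_norm// -sqrtr_sqr ler_wsqrtr// big_ord1.
by rewrite (bigD1 i)//= lerDl sumr_ge0.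
Qed.

(** The weight 1 + s dominates the factor s `^ a produced by the Hoelder bound
    on the cosine, uniformly in a. *)
Lemma osc_holder k th rho t x (v v' : 'rV[R]_d.+1) (a : R) : continuous rho -> 0 < a <= 1 ->
  `|oscS k th rho (t, x, v) - oscS k th rho (t, x, v')| <=
  2 * (\int[@lebesgue_measure R]_(s in `[0, S]) (`|rho s| * (1 + s))) *
  (`|B| * enorm (v - v')) `^ a.
Proof.
move=> cr a01; rewrite /osc opprD addrACA subrr add0r.
have cn : continuous (fun s => `|rho s| * (1 + s)).
  move=> s; apply: cvgM; last by apply: cvgD; [exact: cvg_cst|exact: cvg_id].
  exact: continuous_comp (cr s) (@norm_continuous _ _ _).
have ci p := continuous_osc_integrand (A:=A) (B:=B) (th:=th) (p:=p) cr.
rewrite -integral_itvB// mulrAC -integral_itvZ//; apply: normr_integral_itv_le.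
- by move=> s; apply: cvgB; exact: ci.
- by move=> s; apply: cvgM; [exact: cvg_cst|exact: cn].
move=> s /andP[s0 sS]; rewrite -mulrBr normrM mulrCA ler_wpM2l//.
rewrite (le_trans (cos_holder _ _ a01))// -mulrA ler_wpM2l//.
apply: (@le_trans _ _ ((`|B| * enorm (v - v')) `^ a * s `^ a)); last first.
  by rewrite ler_wpM2l ?powR_ge0// powR_le1D.
rewrite -powRM ?mulr_ge0 ?sqrtr_ge0//.
have /andP[a0 _] := a01.
apply: ge0_ler_powR; rewrite ?nnegrE ?mulr_ge0 ?sqrtr_ge0 ?(ltW a0)//.
rewrite /osc_phase /= (_ : _ - _ = - (B * s * (v - v') 0 0)); last by rewrite !mxE; ring.
rewrite normrN !normrM (ger0_norm s0) mulrAC.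
by rewrite ler_wpM2r// ler_wpM2l// coord_le_enorm.
Qed.

Lemma partial_t_osc k th rho p : continuous rho -> partial_t (oscS k th rho) p = 0.
Proof.
move=> cr; rewrite /partial_t derive_osc// /osc add0r.
rewrite (@eq_Rintegral _ _ _ _ _ (cst 0)) ?Rintegral_cst ?mul0r// => s _ /=.
by rewrite /osc_phase/= !mxE !mulr0 subrr mulr0 mul0r.
Qed.

(** The factor (i == 0) records that only the first coordinate matters. *)
Lemma partial_x_osc k th rho i : continuous rho ->
  partial_x i (oscS k th rho) =
  oscS 0 (th + pi / 2) (fun s => (i == 0)%:R * A * rho s) :> (phase R d.+1 -> R).
Proof.
move=> cr; apply/funext => p; rewrite /partial_x derive_osc//.
rewrite /osc; congr (_ + _); apply: eq_Rintegral => s _; congr (_ * _).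
by rewrite /osc_phase/= !mxE/= eq_sym; ring.
Qed.

Lemma partial_v_osc k th rho i : continuous rho ->
  partial_v i (oscS k th rho) =
  oscS 0 (th + pi / 2) (fun s => - (i == 0)%:R * B * s * rho s) :> (phase R d.+1 -> R).
Proof.
move=> cr; apply/funext => p; rewrite /partial_v derive_osc//.
rewrite /osc; congr (_ + _); apply: eq_Rintegral => s _; congr (_ * _).
by rewrite /osc_phase/= !mxE/= eq_sym; ring.
Qed.

End OscillatoryEstimates.

(** * The velocity seminorm and the Frobenius norm *)

Section HolderSup.
Variables (R : realType) (d : nat) (V : zmodType) (nrm : V -> R).
Variables (a : R) (Q : set (phase R d)) (h : phase R d -> V).

Lemma frob_ge0 m n (M : 'M[R]_(m, n)) : 0 <= frob M.
Proof. exact: sqrtr_ge0. Qed.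

Lemma holder_v_le (K : R) :
  (forall t x v v', Q (t, x, v) -> Q (t, x, v') ->
    nrm (h (t, x, v) - h (t, x, v')) <= K * enorm (v - v') `^ a) ->
  (holder_v_of nrm a Q h <= K%:E)%E.
Proof.
move=> hK; apply: ge_ereal_sup => _ [t [x [v [v' [Qv Qv' /andP[v0 _] ->]]]]].
by rewrite lee_fin ler_pdivrMr ?powR_gt0// hK.
Qed.

Lemma holder_v_ge t x v v' : Q (t, x, v) -> Q (t, x, v') ->
  0 < enorm (v - v') < 1 / 2 ->
  ((nrm (h (t, x, v) - h (t, x, v')) / enorm (v - v') `^ a)%:E <=
    holder_v_of nrm a Q h)%E.
Proof.
by move=> Qv Qv' vv'; apply: ereal_sup_ubound; exists t, x, v, v'.
Qed.

End HolderSup.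

Lemma frob_delta (R : realType) m n (c : R) (i : 'I_m) (j : 'I_n) :
  frob (c *: delta_mx i j) = `|c|.
Proof.
rewrite /frob (bigD1 i)//= (bigD1 j)//= !mxE !eqxx mulr1.
rewrite big1 => [|j' /negPf j'j]; last by rewrite !mxE j'j andbF mulr0 normr0 expr0n.
rewrite big1 => [|i' /negPf i'i]; last first.
  by rewrite big1// => j' _; rewrite !mxE i'i mulr0 normr0 expr0n.
by rewrite !addr0 sqrtr_sqr normr_id.
Qed.

Lemma frob0 (R : realType) m n : frob (0 : 'M[R]_(m, n)) = 0.
Proof.
rewrite /frob big1 ?sqrtr0// => i _; rewrite big1// => j _.
by rewrite mxE normr0 expr0n.
Qed.

(** * The weight exp(-s^3/3) *)

Section Profile.
Variable R : realType.
Implicit Types (s M x v : R).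

(** The Fourier-side weight of the inhomogeneous Airy equation: it solves
    w' = - s^2 w with w(0) = 1. *)
Definition airy_weight s : R := expR (- (s ^+ 3 / 3)).

Lemma airy_weight_ge0 s : 0 <= airy_weight s.
Proof. exact: expR_ge0. Qed.

Lemma is_derive_airy_weight s :
  is_derive s 1 airy_weight (- s ^+ 2 * airy_weight s).
Proof.
have d1 : is_derive s (1 : R) (fun r : R => - (r ^+ 3 / 3)) (- s ^+ 2).
  by apply: is_derive_eq; rewrite /GRing.scale /=; field.
have := @is_derive1_comp R expR (fun r : R => - (r ^+ 3 / 3)) s _ _ (is_derive_expR _) d1.
by move=> d2; apply: is_derive_eq; rewrite mulrC.
Qed.

Lemma continuous_airy_weight : continuous airy_weight.
Proof.
move=> s; apply/differentiable_continuous/derivable1_diffP.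
by have [] := is_derive_airy_weight s.
Qed.

Lemma airy_weight_le s : 0 <= s -> airy_weight s * (1 + s) <= expR 3 * expR (- s).
Proof.
move=> s0; apply: (@le_trans _ _ (airy_weight s * expR s)).
  by rewrite ler_wpM2l ?airy_weight_ge0// expR_ge1Dx.
rewrite -!expRD ler_expR.
(* The tangent to s^3 at s = 3/2 gives 2 s - s^3/3 <= 9/4 <= 3. *)
have : 0 <= (s - 3 / 2) ^+ 2 * (s + 3) by rewrite mulr_ge0 ?sqr_ge0 ?addr_ge0.
rewrite (_ : _ * _ = s ^+ 3 - 27 / 4 * s + 27 / 4); last by field.
lra.
Qed.

Lemma integral_airy_weight_le M : 0 < M ->
  \int[@lebesgue_measure R]_(s in `[0, M]) (airy_weight s * (1 + s)) <= expR 3.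
Proof.
move=> M0.
have de s : is_derive s (1 : R) (fun s => - expR (- s)) (expR (- s)).
  have d1 : is_derive s (1 : R) (fun r : R => - r) (- 1) by apply: is_derive_eq.
  have := @is_derive1_comp R expR (fun r : R => - r) s _ _ (is_derive_expR _) d1.
  by move=> d2; apply: is_derive_eq; rewrite mulrN1 opprK.
have ce : continuous (fun s : R => expR (- s)).
  move=> s; apply: (@continuous_comp _ _ _ -%R expR).
    exact: opp_continuous.
  exact: continuous_expR.
apply: (@le_trans _ _ (\int[@lebesgue_measure R]_(s in `[0, M]) (expR 3 * expR (- s)))).
  apply: le_integral_itv.
  - move=> s; apply: cvgM; first exact: continuous_airy_weight.
    by apply: cvgD; [exact: cvg_cst|exact: cvg_id].
  - by move=> s; apply: cvgM; [exact: cvg_cst|exact: ce].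
  - by move=> s /andP[s0 _]; exact: airy_weight_le.
rewrite integral_itvZ// ler_piMr ?expR_ge0//.
rewrite (integral_itv_derive M0 ce de) oppr0 expR0 opprK.
by rewrite gerDr oppr_le0 expR_ge0.
Qed.

(** The identity behind the equation for u: the integrand is the derivative of
    - w(s) cos(x - s v), and the end point s = 0 contributes cos x, which is
    free of v. *)
Lemma integral_airy_weight_ibp M x v : 0 < M ->
  \int[@lebesgue_measure R]_(s in `[0, M])
    (airy_weight s * (s ^+ 2 * cos (x - s * v) - v * sin (x - s * v))) =
  cos x - airy_weight M * cos (x - M * v).
Proof.
move=> M0.
pose F s := - (airy_weight s * cos (x - s * v)).
have dF s : is_derive s (1 : R) F
    (airy_weight s * (s ^+ 2 * cos (x - s * v) - v * sin (x - s * v))).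
  have d1 : is_derive s (1 : R) (fun r : R => x - r * v) (- v).
    by apply: is_derive_eq; rewrite /GRing.scale /=; ring.
  have d2 := @is_derive1_comp R cos (fun r : R => x - r * v) s _ _ (is_derive_cos _) d1.
  have d3 := is_derive_airy_weight s.
  by apply: is_derive_eq; rewrite /GRing.scale /=; ring.
rewrite (integral_itv_derive M0 _ dF).
  rewrite /F /airy_weight mul0r subr0 expr0n mul0r oppr0 expR0; ring.
have cp : continuous (fun s => x - s * v).
  move=> s; apply: cvgB; first exact: cvg_cst.
  by apply: cvgM; [exact: cvg_id|exact: cvg_cst].
move=> s; apply: cvgM; first exact: continuous_airy_weight.
apply: cvgB.
  apply: cvgM; first exact: exprn_continuous.
  exact: continuous_comp (cp s) (@continuous_cos _ _).
apply: cvgM; first exact: cvg_cst.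
exact: continuous_comp (cp s) (@continuous_sin _ _).
Qed.

Lemma airy_weight_tail M : 1 <= M -> M ^+ 3 * airy_weight M <= 3.
Proof.
move=> M1; rewrite /airy_weight expRN ler_pdivrMr ?expR_gt0//.
have := expR_ge1Dx (M ^+ 3 / 3); lra.
Qed.

(** A lower bound for w(s) s^2 (1 - cos(s/4)) on [1/2, 1]. *)
Definition osc_gap : R := expR (- 3^-1) * 4^-1 * (1 - cos (1 / 8)).

Lemma osc_gap_gt0 : 0 < osc_gap.
Proof.
have pi2 := pi_ge2 R.
rewrite /osc_gap mulr_gt0 ?mulr_gt0 ?expR_gt0 ?invr_gt0// subr_gt0 -[ltRHS]cos0.
by rewrite ltr_cos ?in_itv/=; lra.
Qed.

(** The oscillation of the second derivative of the profile between v = 0 and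
    v = 1/4 does not degenerate as M grows. *)
Lemma integral_airy_weight_gap M : 1 <= M ->
  osc_gap / 12 <= \int[@lebesgue_measure R]_(s in `[0, M])
    (airy_weight s * s ^+ 2 * (1 - cos (s / 4))).
Proof.
move=> M1; pose f s := airy_weight s * s ^+ 2 * (1 - cos (s / 4)).
rewrite -/f.
have cf : continuous f.
  move=> s; apply: cvgM.
    by apply: cvgM; [exact: continuous_airy_weight|exact: exprn_continuous].
  apply: cvgB; first exact: cvg_cst.
  apply: (@continuous_comp _ _ _ (fun s : R => s / 4) cos); last exact: continuous_cos.
  by apply: cvgM; [exact: cvg_id|exact: cvg_cst].
have f0 s : 0 <= f s.
  apply: mulr_ge0; last by rewrite subr_ge0 cos_le1.
  by apply: mulr_ge0; [exact: airy_weight_ge0|exact: sqr_ge0].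
apply: (@le_trans _ _ (\int[@lebesgue_measure R]_(s in `[0, 1]) f s)); last first.
  rewrite -subr_ge0 (@Rintegral_itvB R f (BLeft 0) (BRight M) 1)//.
  - by apply: Rintegral_ge0 => s _; exact: f0.
  - exact: continuous_integrable_itv.
  - by rewrite bnd_simp.
(* On [0, 1] the integrand is at least osc_gap (s^2 - 1/4), which is negative
   for s < 1/2 and has integral osc_gap (1/3 - 1/4). *)
have dg s : is_derive s (1 : R) (fun s => osc_gap * (s ^+ 3 / 3 - s / 4))
    (osc_gap * (s ^+ 2 - 4^-1)).
  by apply: is_derive_eq; rewrite /GRing.scale /=; field.
have cg : continuous (fun s : R => osc_gap * (s ^+ 2 - 4^-1)).
  move=> s; apply: cvgM; first exact: cvg_cst.
  by apply: cvgB; [exact: exprn_continuous|exact: cvg_cst].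
have := integral_itv_derive ltr01 cg dg.
rewrite (_ : _ - _ = osc_gap / 12); last by field.
move=> <-; apply: le_integral_itv => // s /andP[s0 s1].
have g0 := osc_gap_gt0.
have [sh|sh] := leP s (1 / 2).
  apply: (@le_trans _ _ 0) => //; rewrite mulr_ge0_le0 ?(ltW g0)//.
  by nra.
apply: (@le_trans _ _ osc_gap).
  by rewrite ler_piMr ?(ltW g0)//; nra.
have c8 : cos (s / 4) <= cos (1 / 8).
  have pi2 := pi_ge2 R.
  by rewrite ltW// ltr_cos ?in_itv/=; lra.
rewrite /osc_gap /f; apply: ler_pM.
- by rewrite mulr_ge0 ?expR_ge0.
- by rewrite subr_ge0 cos_le1.
- apply: ler_pM; rewrite ?expR_ge0//.
    rewrite ler_expR lerN2; have : s ^+ 3 <= 1 by rewrite exprn_ile1.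
    lra.
  nra.
- lra.
Qed.

End Profile.

(** * The stationary solution and its potential *)

Section Solution.
Variables (R : realType) (d : nat).
Implicit Types (M a : R) (p : phase R d.+1) (t : R) (x v : 'rV[R]_d.+1).

(** The constant k: since the integral of w(s) (1 + s) is at most e^3, it keeps
    u within 1/2 of 1. *)
Definition amplitude : R := (2 * expR 3)^-1.

Lemma amplitude_gt0 : 0 < amplitude.
Proof. by rewrite invr_gt0 mulr_gt0 ?expR_gt0. Qed.

Lemma amplitude_le : amplitude <= 2^-1.
Proof.
rewrite lef_pV2 ?posrE ?mulr_gt0 ?expR_gt0// ler_peMr//.
by rewrite -[leLHS]expR0 ler_expR.
Qed.

(** The weight k M^-2 exp(-s^3/3). *)
Definition kolm_weight M (s : R) : R := amplitude / M ^+ 2 * airy_weight s.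

(** The solution u, with x-frequency M^3 and v-frequency M; the integral is
    truncated at s = M. *)
Definition kolm_sol M : phase R d.+1 -> R :=
  osc M (M ^+ 3) M 1 0 (kolm_weight M).

(** The right-hand side F = v . grad_x u - Delta_v u. *)
Definition kolm_force M p : R :=
  amplitude * (cos (M ^+ 3 * p.1.2 0 0) -
    airy_weight M * cos (M ^+ 3 * p.1.2 0 0 - M * (M * p.2 0 0))).

(** The potential c = F / u. *)
Definition kolm_coef M p : R := kolm_force M p / kolm_sol M p.

Lemma continuous_kolm_weight M : continuous (kolm_weight M).
Proof.
by move=> s; apply: cvgM; [exact: cvg_cst|exact: continuous_airy_weight].
Qed.

Lemma kolm_weight_ge0 M s : 0 <= kolm_weight M s.
Proof.
apply: mulr_ge0; last exact: airy_weight_ge0.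
by rewrite divr_ge0 ?sqr_ge0// ltW// amplitude_gt0.
Qed.

Lemma integral_kolm_weight_le M : 1 <= M ->
  \int[@lebesgue_measure R]_(s in `[0, M]) (`|kolm_weight M s| * (1 + s)) <=
  2^-1 / M ^+ 2.
Proof.
move=> M1; have M0 : 0 < M by exact: lt_le_trans M1.
under eq_Rintegral do rewrite (ger0_norm (kolm_weight_ge0 _ _)) -mulrA.
rewrite integral_itvZ; last first.
  move=> s; apply: cvgM; first exact: continuous_airy_weight.
  by apply: cvgD; [exact: cvg_cst|exact: cvg_id].
rewrite mulrAC ler_wpM2r ?invr_ge0 ?sqr_ge0//.
apply: (@le_trans _ _ (amplitude * expR 3)).
  by rewrite ler_wpM2l ?(ltW amplitude_gt0)// integral_airy_weight_le.
by rewrite /amplitude invfM mulfVK// gt_eqF ?expR_gt0.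
Qed.

Lemma kolm_sol_bounds M p : 1 <= M -> 1 / 2 <= kolm_sol M p <= 3 / 2.
Proof.
move=> M1; have cw := @continuous_kolm_weight M.
have M0 : 0 <= M by rewrite (le_trans _ M1).
have := osc_le M (M ^+ 3) M 1 0 p cw; rewrite -/(kolm_sol M p).
have : \int[@lebesgue_measure R]_(s in `[0, M]) `|kolm_weight M s| <= 2^-1.
  apply: (@le_trans _ _ (\int[@lebesgue_measure R]_(s in `[0, M])
    (`|kolm_weight M s| * (1 + s)))).
    have cn : continuous (fun s => `|kolm_weight M s|).
      by move=> s; exact: continuous_comp (cw s) (@norm_continuous _ _ _).
    apply: le_integral_itv => //.
      move=> s; apply: cvgM; first exact: cn.
      by apply: cvgD; [exact: cvg_cst|exact: cvg_id].
    by move=> s /andP[s0 _]; rewrite ler_peMr// lerDl.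
  apply: (le_trans (integral_kolm_weight_le M1)).
  by rewrite ler_piMr// invf_le1 ?exprn_gt0 ?expr_ge1 ?(lt_le_trans _ M1).
by rewrite ler_norml => *; lra.
Qed.

Lemma smooth_kolm_sol Q M : 1 <= M -> smooth_on Q (kolm_sol M).
Proof.
move=> M1; apply: smooth_osc; last exact: continuous_kolm_weight.
by rewrite (le_trans _ M1).
Qed.

(** The phase shift pi/2 + pi/2 carries the sign of the second derivative of
    the cosine. *)
Lemma hess_kolm_sol M p : 1 <= M -> hess_v (kolm_sol M) p =
  osc M (M ^+ 3) M 0 (0 + pi / 2 + pi / 2)
    (fun s => amplitude * s ^+ 2 * airy_weight s) p *: delta_mx 0 0.
Proof.
move=> M1; have M0 : 0 <= M by rewrite (le_trans _ M1).
have Mn0 : M != 0 by rewrite gt_eqF// (lt_le_trans _ M1).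
have cw := @continuous_kolm_weight M.
have ca := @continuous_airy_weight R.
have cl (c : R) : continuous (fun s : R => c * s * kolm_weight M s).
  move=> s; apply: cvgM; last exact: cw.
  by apply: cvgM; [exact: cvg_cst|exact: cvg_id].
apply/matrixP => i j; rewrite !mxE partial_v_osc// partial_v_osc//.
rewrite /osc !add0r -RintegralZr//; last first.
  apply/continuous_integrable_itv/continuous_osc_integrand => s.
  apply: cvgM; last exact: ca.
  by apply: cvgM; [exact: cvg_cst|exact: exprn_continuous].
apply: eq_Rintegral => s _; rewrite /kolm_weight.
by case: (i == 0); case: (j == 0) => /=; rewrite ?mulr1n ?mulr0n; field.
Qed.

Lemma laplace_v_trace (f : phase R d.+1 -> R) p : laplace_v f p = \tr (hess_v f p).
Proof. by rewrite /mxtrace; apply: eq_bigr => i _; rewrite mxE. Qed.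

Lemma kolm_sol_equation M p : 1 <= M ->
  transport (kolm_sol M) p =
  laplace_v (kolm_sol M) p + kolm_coef M p * kolm_sol M p.
Proof.
move=> M1; have M0 : 0 <= M by rewrite (le_trans _ M1).
have M00 : 0 < M by rewrite (lt_le_trans _ M1).
have Mn0 : M != 0 by rewrite gt_eqF// (lt_le_trans _ M1).
have cw := @continuous_kolm_weight M.
have ca := @continuous_airy_weight R.
rewrite divfK; last first.
  by have /andP[+ _] := kolm_sol_bounds p M1; move=> u2; apply/eqP => u0; lra.
have -> : laplace_v (kolm_sol M) p =
    osc M (M ^+ 3) M 0 (0 + pi / 2 + pi / 2)
      (fun s => amplitude * s ^+ 2 * airy_weight s) p.
  rewrite laplace_v_trace hess_kolm_sol// mxtraceZ /mxtrace (bigD1 ord0)//= big1.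
    by rewrite !mxE eqxx addr0 mulr1.
  by move=> i /negPf i0; rewrite !mxE i0.
rewrite /transport partial_t_osc// add0r (bigD1 ord0)//= big1 => [|i /negPf i0]; last first.
  rewrite partial_x_osc// i0 /osc add0r.
  rewrite (@eq_Rintegral _ _ _ _ _ (cst 0)) ?Rintegral_cst ?mul0r ?mulr0// => s _ /=.
  by rewrite !mul0r.
rewrite addr0 partial_x_osc// /osc !add0r eqxx mul1r.
set v0 := p.2 0 0; set x0 := p.1.2 0 0.
rewrite /kolm_force -/v0 -/x0 -integral_airy_weight_ibp//.
have ci th (f : R -> R) : continuous f ->
    continuous (fun s => f s * cos (th + osc_phase (M ^+ 3) M s p)).
  exact: continuous_osc_integrand.
have c1 := ci (pi / 2) (fun s => M ^+ 3 * kolm_weight M s).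
have c2 := ci (pi / 2 + pi / 2) (fun s => amplitude * s ^+ 2 * airy_weight s).
rewrite [RHS]addrC; apply: (canRL (subrK _)).
rewrite -integral_itvZ; last first.
  by apply: c1 => s; apply: cvgM; [exact: cvg_cst|exact: cw].
rewrite -integral_itvB; first last.
- apply: c2 => s; apply: cvgM; last exact: ca.
  by apply: cvgM; [exact: cvg_cst|exact: exprn_continuous].
- move=> s; apply: cvgM; first exact: cvg_cst.
  by apply: c1 => r; apply: cvgM; [exact: cvg_cst|exact: cw].
rewrite -integral_itvZ; last first.
  move=> s; apply: cvgM; first exact: ca.
  have cp : continuous (fun s : R => M ^+ 3 * x0 - s * (M * v0)).
    move=> r; apply: cvgB; first exact: cvg_cst.
    by apply: cvgM; [exact: cvg_id|exact: cvg_cst].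
  apply: cvgB.
    apply: cvgM; first exact: exprn_continuous.
    exact: continuous_comp (cp s) (@continuous_cos _ _).
  apply: cvgM; first exact: cvg_cst.
  exact: continuous_comp (cp s) (@continuous_sin _ _).
apply: eq_Rintegral => s _.
rewrite /osc_phase -/v0 -/x0 (addrC (pi / 2)) cosDpihalf (addrC (pi / 2 + pi / 2)) addrA.
rewrite cosDpihalf sinDpihalf (_ : M * s * v0 = s * (M * v0)); last by ring.
by rewrite /kolm_weight; field.
Qed.

Lemma kolm_force_le M p : 1 <= M -> `|kolm_force M p| <= 1.
Proof.
move=> M1; have a0 := amplitude_gt0; have a1 := amplitude_le.
rewrite /kolm_force normrM (ger0_norm (ltW a0)).
set y := cos _; set z := cos _; set w := airy_weight M.
have y1 : `|y| <= 1 by rewrite ler_norml cos_le1 cos_geN1.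
have z1 : `|z| <= 1 by rewrite ler_norml cos_le1 cos_geN1.
have w0 : 0 <= w by exact: airy_weight_ge0.
have w1 : w <= 1.
  by rewrite -[leRHS]expR0 ler_expR oppr_le0 divr_ge0// exprn_ge0// (le_trans _ M1).
have : `|y - w * z| <= 2.
  rewrite (le_trans (ler_normB _ _))// (_ : 2 = 1 + 1 :> R)// lerD//.
  by rewrite normrM mulr_ile1// ger0_norm.
have := normr_ge0 (y - w * z); nra.
Qed.

Lemma kolm_coef_le M p : 1 <= M -> `|kolm_coef M p| <= 2.
Proof.
move=> M1; have /andP[u0 _] := kolm_sol_bounds p M1.
have f1 := kolm_force_le p M1.
rewrite normrM normfV (@ger0_norm _ (kolm_sol M p)); last lra.
by rewrite ler_pdivrMr; lra.
Qed.

Lemma kolm_sol_holder M t x v v' a : 1 <= M -> 0 < a < 1 ->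
  `|kolm_sol M (t, x, v) - kolm_sol M (t, x, v')| <=
  M `^ (a - 2) * enorm (v - v') `^ a.
Proof.
move=> M1 /andP[a0 a1]; have M0 : 0 < M by rewrite (lt_le_trans _ M1).
have a01 : 0 < a <= 1 by rewrite a0 ltW.
apply: (le_trans (osc_holder _ _ _ _ _ _ _ _ _ (@continuous_kolm_weight M) a01)).
rewrite powRM ?frob_ge0// mulrA ler_wpM2r ?powR_ge0// (gtr0_norm M0).
rewrite powRB; last by rewrite (gt_eqF M0) implybT.
rewrite powR_mulrn ?(ltW M0)// mulrC ler_wpM2l ?powR_ge0//.
have := integral_kolm_weight_le M1; lra.
Qed.

(** Only the term at s = M depends on v, and its exponential smallness beats
    every power of M. *)
Lemma kolm_force_holder M t x v v' a : 1 <= M -> 0 < a < 1 ->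
  `|kolm_force M (t, x, v) - kolm_force M (t, x, v')| <=
  3 * M `^ (a - 2) * enorm (v - v') `^ a.
Proof.
move=> M1 /andP[a0 a1]; have M0 : 0 < M by rewrite (lt_le_trans _ M1).
have a01 : 0 < a <= 1 by rewrite a0 ltW.
have k0 := amplitude_gt0; have k1 := amplitude_le.
rewrite /kolm_force /= -mulrBr normrM (gtr0_norm k0).
rewrite opprB addrC addrA subrK -mulrBr normrM (ger0_norm (airy_weight_ge0 M)).
set D := enorm (v - v') `^ a.
have D0 : 0 <= D by exact: powR_ge0.
have cD : `|cos (M ^+ 3 * x 0 0 - M * (M * v' 0 0)) -
    cos (M ^+ 3 * x 0 0 - M * (M * v 0 0))| <= 2 * ((M * M) `^ a * D).
  apply: (le_trans (cos_holder _ _ a01)); rewrite ler_wpM2l//.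
  rewrite -powRM ?mulr_ge0 ?frob_ge0 ?(ltW M0)//.
  apply: ge0_ler_powR; rewrite ?nnegrE ?mulr_ge0 ?frob_ge0 ?(ltW M0) ?(ltW a0)//.
  rewrite (_ : _ - _ = M * M * (v - v') 0 0); last by rewrite !mxE; ring.
  rewrite normrM (ger0_norm (mulr_ge0 (ltW M0) (ltW M0))).
  by rewrite ler_wpM2l ?mulr_ge0 ?(ltW M0)// coord_le_enorm.
have w0 := airy_weight_ge0 M.
have wM : airy_weight M * (M * M) `^ a <= 3 * M `^ (a - 2).
  rewrite powRM ?(ltW M0)// powRB; last by rewrite (gt_eqF M0) implybT.
  rewrite powR_mulrn ?(ltW M0)// (mulrCA 3) (mulrCA (airy_weight M)) ler_wpM2l ?powR_ge0//.
  rewrite ler_pdivlMr ?exprn_gt0//.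
  apply: le_trans (airy_weight_tail M1).
  rewrite (_ : M ^+ 3 * _ = airy_weight M * M * M ^+ 2); last by ring.
  by rewrite ler_wpM2r ?sqr_ge0// ler_wpM2l// ler1_powR// ltW.
have X0 : 0 <= (M * M) `^ a by exact: powR_ge0.
apply: (@le_trans _ _ (2^-1 * (airy_weight M * (2 * ((M * M) `^ a * D))))).
  apply: ler_pM => //; first exact: ltW.
    by rewrite mulr_ge0.
  by rewrite ler_wpM2l.
rewrite [leLHS](_ : _ = airy_weight M * (M * M) `^ a * D); last by field.
by rewrite ler_wpM2r.
Qed.

Lemma kolm_coef_holder M t x v v' a : 1 <= M -> 0 < a < 1 ->
  `|kolm_coef M (t, x, v) - kolm_coef M (t, x, v')| <=
  10 * M `^ (a - 2) * enorm (v - v') `^ a.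
Proof.
move=> M1 a01.
have := kolm_force_holder t x v v' M1 a01.
have := kolm_sol_holder t x v v' M1 a01.
have := kolm_coef_le (t, x, v') M1.
have /andP[] := kolm_sol_bounds (t, x, v) M1.
have /andP[] := kolm_sol_bounds (t, x, v') M1.
rewrite /kolm_coef.
set f := kolm_force M (t, x, v); set f' := kolm_force M (t, x, v').
set u := kolm_sol M (t, x, v); set u' := kolm_sol M (t, x, v').
rewrite -!(mulrA _ (M `^ (a - 2))); set E := M `^ (a - 2) * _.
move=> u1 u2 u3 u4 c' uE fE.
have un0 : u != 0 by rewrite gt_eqF//; lra.
have u'n0 : u' != 0 by rewrite gt_eqF//; lra.
rewrite (_ : f / u - f' / u' = ((f - f') + (f' / u') * (u' - u)) / u); last first.
  by field; rewrite un0 u'n0.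
rewrite normrM normfV (@ger0_norm _ u); last lra.
rewrite ler_pdivrMr; last lra.
(* As u >= 1/2, the constant is 10 = (3 + 2) / (1/2). *)
apply: (le_trans (ler_normD _ _)).
have : `|f' / u' * (u' - u)| <= 2 * E.
  by rewrite normrM ler_pM// distrC.
have : 0 <= E by rewrite (le_trans _ uE).
nra.
Qed.

(** A bound for each fixed M only: it shows that the seminorm is finite. *)
Lemma hess_kolm_sol_holder M t x v v' a : 1 <= M -> 0 < a < 1 ->
  frob (hess_v (kolm_sol M) (t, x, v) - hess_v (kolm_sol M) (t, x, v')) <=
  2 * (\int[@lebesgue_measure R]_(s in `[0, M])
    (`|amplitude * s ^+ 2 * airy_weight s| * (1 + s))) * M `^ a *
  enorm (v - v') `^ a.
Proof.
move=> M1 /andP[a0 a1]; have M0 : 0 < M by rewrite (lt_le_trans _ M1).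
have a01 : 0 < a <= 1 by rewrite a0 ltW.
rewrite !hess_kolm_sol// -scalerBl frob_delta.
apply: (le_trans (osc_holder _ _ _ _ _ _ _ _ _ _ a01)).
  move=> s; apply: cvgM; last exact: continuous_airy_weight.
  by apply: cvgM; [exact: cvg_cst|exact: exprn_continuous].
by rewrite powRM ?frob_ge0// mulrA (gtr0_norm M0).
Qed.

Lemma hess_kolm_sol_le M p : 1 <= M ->
  frob (hess_v (kolm_sol M) p) <= \int[@lebesgue_measure R]_(s in `[0, M])
    `|amplitude * s ^+ 2 * airy_weight s|.
Proof.
move=> M1; rewrite hess_kolm_sol// frob_delta.
rewrite -[X in `|X|]subr0; apply: osc_le => s.
apply: cvgM; last exact: continuous_airy_weight.
by apply: cvgM; [exact: cvg_cst|exact: exprn_continuous].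
Qed.

Lemma hess_kolm_sol_gap M : 1 <= M ->
  amplitude * (osc_gap R / 12) <=
  frob (hess_v (kolm_sol M) (0, 0, 0) -
        hess_v (kolm_sol M) (0, 0, (4 * M)^-1 *: delta_mx 0 0)).
Proof.
move=> M1; have M0 : 0 < M by rewrite (lt_le_trans _ M1).
rewrite !hess_kolm_sol// -scalerBl frob_delta distrC.
apply: le_trans (ler_norm _).
apply: (@le_trans _ _ (amplitude * \int[@lebesgue_measure R]_(s in `[0, M])
    (airy_weight s * s ^+ 2 * (1 - cos (s / 4))))).
  by rewrite ler_wpM2l ?(ltW amplitude_gt0)// integral_airy_weight_gap.
have cc : continuous (fun s : R => amplitude * s ^+ 2 * airy_weight s).
  move=> s; apply: cvgM; last exact: continuous_airy_weight.
  by apply: cvgM; [exact: cvg_cst|exact: exprn_continuous].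
rewrite /osc !add0r -integral_itvZ; last first.
  move=> s; apply: cvgM.
    by apply: cvgM; [exact: continuous_airy_weight|exact: exprn_continuous].
  apply: cvgB; first exact: cvg_cst.
  apply: (@continuous_comp _ _ _ (fun s : R => s / 4) cos); last exact: continuous_cos.
  by apply: cvgM; [exact: cvg_id|exact: cvg_cst].
rewrite -integral_itvB; [|exact: continuous_osc_integrand..].
rewrite le_eqVlt; apply/orP; left; apply/eqP; apply: eq_Rintegral => s _.
rewrite /osc_phase /= !mxE eqxx mulr0 mulr1 mulr0 !sub0r subr0.
rewrite (_ : M * s / (4 * M) = s / 4); last by field; rewrite gt_eqF.
rewrite (addrC _ (- (s / 4))) (addrA (- (s / 4))) !cosDpihalf sinDpihalf cosN.
by rewrite sin_pihalf; ring.
Qed.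

End Solution.

(** * Growth of the Hessian seminorm and failure of the estimate *)

Lemma near_pinfty_powR_ge (R : realType) (b A : R) : 0 < b ->
  \forall N \near +oo, A <= N `^ b.
Proof.
move=> b0; near=> N.
have N1 : 1 <= N by near: N; exact: nbhs_pinfty_ge (num_real _).
have N0 : 0 <= N by rewrite (le_trans _ N1).
have NA : `|A| `^ b^-1 <= N by near: N; exact: nbhs_pinfty_ge (num_real _).
rewrite (le_trans (ler_norm A))//.
have := ge0_ler_powR (ltW b0) _ _ NA; rewrite -powRrM mulVf ?gt_eqF// powRr1//.
by apply; rewrite nnegrE// powR_ge0.
Unshelve. all: by end_near. Qed.

Section Cylinder.
Variables (R : realType) (d : nat).

Lemma enorm0 m : enorm (0 : 'rV[R]_m) = 0.
Proof. exact: frob0. Qed.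

Lemma cylinder_axis (r c : R) : 0 < r -> `|c| < r ->
  cylinder (d:=d.+1) r (0, 0, c *: delta_mx 0 0).
Proof.
move=> r0 cr; split => /=.
- by rewrite lexx oppr_lt0 exprn_gt0.
- by rewrite enorm0 exprn_gt0.
- by rewrite /enorm frob_delta.
Qed.

Lemma cylinder_origin (r : R) : 0 < r -> cylinder (d:=d.+1) r (0, 0, 0).
Proof.
move=> r0; rewrite -[X in (_, _, X)](scale0r (delta_mx 0 0)).
by apply: cylinder_axis; rewrite ?normr0.
Qed.

Lemma enorm_axis (c : R) : enorm (0 - c *: delta_mx 0 0 : 'rV[R]_d.+1) = `|c|.
Proof. by rewrite sub0r -scaleNr /enorm frob_delta normrN. Qed.

(** The supremum defining the seminorm is over a nonempty set, so that it is not
    the default value -oo. *)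
Lemma holder_v_ge0 (V : zmodType) (nrm : V -> R) a (h : phase R d.+1 -> V) :
  (forall y, 0 <= nrm y) -> (0 <= holder_v_of nrm a (cylinder 1) h)%E.
Proof.
move=> nrm0.
have Q0 := cylinder_origin ltr01.
have Qv : cylinder (d:=d.+1) 1 (0, 0, (1 / 4 : R) *: delta_mx 0 0).
  by apply: cylinder_axis => //; rewrite ger0_norm; lra.
apply: le_trans (holder_v_ge nrm a h Q0 Qv _); last first.
  by rewrite enorm_axis ger0_norm; lra.
by rewrite lee_fin divr_ge0// powR_ge0.
Qed.

Lemma holder_v_cst (V : zmodType) (nrm : V -> R) a (y : V) :
  (forall y, 0 <= nrm y) -> nrm 0 = 0 ->
  holder_v_of nrm a (cylinder (d:=d.+1) 1) (fun=> y) = 0%E.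
Proof.
move=> nrm0 n0; apply/eqP; rewrite eq_le holder_v_ge0// andbT.
by apply: holder_v_le => *; rewrite subrr n0 mul0r.
Qed.

Lemma hess_kolm_sol_holder_ge (M a : R) : 1 <= M -> 0 < a ->
  ((amplitude R * (osc_gap R / 12) * M `^ a)%:E <=
   holder_v_mx a (@cylinder R d.+1 (1 / 2)) (hess_v (kolm_sol M)))%E.
Proof.
move=> M1 a0; have M0 : 0 < M by rewrite (lt_le_trans _ M1).
have M4 : 0 < (4 * M)^-1 by rewrite invr_gt0 mulr_gt0.
have M4h : (4 * M)^-1 < 1 / 2.
  by rewrite div1r ltf_pV2 ?posrE ?mulr_gt0//; lra.
have Q0 : @cylinder R d.+1 (1 / 2) (0, 0, 0) by apply: cylinder_origin; lra.
have Qv : @cylinder R d.+1 (1 / 2) (0, 0, (4 * M)^-1 *: delta_mx 0 0).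
  by apply: cylinder_axis; rewrite ?(gtr0_norm M4); lra.
(* The distance 1/(4M) compensates the frequency M and is below 1/2. *)
apply: le_trans (holder_v_ge _ _ _ Q0 Qv _); last first.
  by rewrite enorm_axis (gtr0_norm M4) M4.
rewrite lee_fin enorm_axis (gtr0_norm M4) ler_pdivlMr ?powR_gt0//.
apply: le_trans (hess_kolm_sol_gap d M1).
rewrite -(mulrA _ (M `^ a)) -powRM ?(ltW M0) ?(ltW M4)//.
have k0 := amplitude_gt0 R; have g0 := osc_gap_gt0 R.
rewrite ler_piMr ?mulr_ge0 ?divr_ge0 ?(ltW k0) ?(ltW g0)//.
have M4e : M / (4 * M) <= 1 by rewrite ler_pdivrMr ?mulr_gt0//; lra.
have := ge0_ler_powR (ltW a0) _ _ M4e; rewrite powR1; apply; rewrite nnegrE//.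
by rewrite mulr_ge0 ?ltW.
Qed.

End Cylinder.

Unset Implicit Arguments.
Set Strict Implicit.
Set Printing Implicit Defensive.

Theorem proposition3p1 (R : realType) (d : nat) (alpha : R)
    (hd : (1 <= d)%N) (halpha : 0 < alpha < 1) :
  let Q1 := @cylinder R d 1 in
  let Qh := @cylinder R d (1 / 2) in
  exists (C c N0 : R) (cN uN : R -> phase R d -> R),
    [/\ 0 < C, 0 < c & 1 <= N0] /\
    (forall N : R, N0 <= N ->
      (smooth_on Q1 (uN N) /\ stationary_on Q1 (uN N)) /\
      (forall p, Q1 p ->
         transport (uN N) p = laplace_v (uN N) p + cN N p * uN N p) /\
      (forall p, Q1 p -> 1 / 2 <= uN N p <= 3 / 2) /\
      (sup_norm Q1 (cN N) <= C%:E)%E /\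
      (holder_v alpha Q1 (cN N) <= (C * N `^ ((alpha - 2) / 3))%:E)%E /\
      ((c * N `^ (alpha / 3))%:E <= holder_v_mx alpha Qh (hess_v (uN N)))%E) /\
    (holder_v alpha Q1 (cN N) @[N --> +oo] --> 0%E) /\
    (holder_v_mx alpha Qh (hess_v (uN N)) @[N --> +oo] --> +oo%E) /\
    (forall Lambda : R, 1 < Lambda -> C <= Lambda ->
      ~ exists C' : R,
        forall (f b : phase R d -> R) (a : phase R d -> 'M[R]_d),
          smooth_on Q1 f ->
          (forall p, Q1 p ->
             transport f p = \tr (a p *m hess_v f p) + b p * f p) ->
          (forall p, Q1 p ->
             qform_le (Lambda^-1)%:M (a p) /\ qform_le (a p) Lambda%:M) ->
          (forall p, Q1 p -> `|b p| <= Lambda) ->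
          Cv alpha Q1 f -> Cv_mx alpha Q1 (hess_v f) ->
          Cv_mx alpha Q1 a -> Cv alpha Q1 b ->
          (holder_v_mx alpha Qh (hess_v f) <=
             C'%:E * (1 + holder_v alpha Q1 b
                        + poweR (holder_v_mx alpha Q1 a) (1 + 2 / alpha)%R)
             * sup_norm Q1 f)%E).
Proof.
case: d hd => // d _ Q1 Qh.
have /andP[a0 a1] := halpha.
have k0 := amplitude_gt0 R; have g0 := osc_gap_gt0 R.
pose M (N : R) : R := N `^ (1 / 3).
have M1 N : 1 <= N -> 1 <= M N.
  by move=> N1; rewrite -(powRr0 N) ler_powR.
have ME N e : M N `^ e = N `^ (e / 3).
  by rewrite /M -powRrM; congr (_ `^ _); field.
pose c := amplitude R * (osc_gap R / 12).
have c0 : 0 < c by rewrite /c mulr_gt0// divr_gt0.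
have coefH N : 1 <= N ->
    (holder_v alpha Q1 (@kolm_coef R d (M N)) <= (10 * N `^ ((alpha - 2) / 3))%:E)%E.
  move=> N1; rewrite -ME; apply: holder_v_le => *.
  exact: kolm_coef_holder (M1 _ N1) halpha.
have hessH N : 1 <= N ->
    ((c * N `^ (alpha / 3))%:E <= holder_v_mx alpha Qh (hess_v (@kolm_sol R d (M N))))%E.
  by move=> N1; rewrite -ME; exact: hess_kolm_sol_holder_ge (M1 _ N1) a0.
have hess_oo : holder_v_mx alpha Qh (hess_v (@kolm_sol R d (M N))) @[N --> +oo] --> +oo%E.
  apply/cvgeyPge => A; near=> N.
  have N1 : 1 <= N by near: N; exact: nbhs_pinfty_ge (num_real _).
  apply: le_trans (hessH N N1); rewrite lee_fin mulrC -ler_pdivrMr//.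
  by near: N; apply: near_pinfty_powR_ge; rewrite divr_gt0.
exists 10, c, 1, (fun N => kolm_coef (M N)), (fun N => kolm_sol (M N)).
split; first by split.
split.
  move=> N N1; have MN := M1 N N1; split.
    split; first exact: smooth_kolm_sol.
    by move=> t t' x v _ _.
  split; first by move=> p _; exact: kolm_sol_equation.
  split; first by move=> p _; exact: kolm_sol_bounds.
  split; last by split; [exact: coefH|exact: hessH].
  apply: ge_ereal_sup => _ [p _ <-]; rewrite lee_fin.
  by rewrite (le_trans (kolm_coef_le _ MN))//; lra.
split.
  apply: (@squeeze_cvge _ _ _ _ (cst 0%E) _ (fun N => (10 * N `^ ((alpha - 2) / 3))%:E)).
  - near=> N; have N1 : 1 <= N by near: N; exact: nbhs_pinfty_ge (num_real _).
    by rewrite holder_v_ge0//= coefH.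
  - exact: cvg_cst.
  - apply: cvg_EFin; first by near=> N.
    apply/cvgr0Pnorm_le => e e0; near=> N.
    rewrite /= ger0_norm ?mulr_ge0 ?powR_ge0//.
    rewrite (_ : (alpha - 2) / 3 = - ((2 - alpha) / 3)); last by field.
    have N0 : 0 < N by near: N; exact: nbhs_pinfty_gt (num_real _).
    rewrite powRN ler_pdivrMr ?powR_gt0// mulrC -ler_pdivrMr//.
    near: N; apply: near_pinfty_powR_ge; rewrite divr_gt0// subr_gt0; lra.
split=> [//|L L1 CL [C' HC']].
have L0 : 0 < L by rewrite (lt_trans _ L1).
(* For N large, u violates the estimate with a = Id and b = c: there the
   right-hand side is at most K, whatever N. *)
near (+oo : set_system R) => N.
have N1 : 1 <= N by near: N; exact: nbhs_pinfty_ge (num_real _).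
have MN := M1 N N1.
have MN0 : 0 < M N by rewrite (lt_le_trans _ MN).
pose K := `|C'| * (1 + 10) * (3 / 2).
have NK : (K%:E < holder_v_mx alpha Qh (hess_v (@kolm_sol R d (M N))))%E.
  by near: N; move/cvgeyPgt : hess_oo; exact.
move: NK; apply/negP; rewrite -leNgt.
have qform (r s : R) : r <= s -> qform_le r%:M s%:M.
  move=> rs w; rewrite !mul_mx_scalar -!scalemxAl !mxE ler_wpM2r//.
  by apply: sumr_ge0 => i _; rewrite !mxE -expr2 sqr_ge0.
have coefH1 : (holder_v alpha Q1 (@kolm_coef R d (M N)) <= 10%:E)%E.
  apply: (le_trans (coefH N N1)); rewrite lee_fin ler_piMr//.
  rewrite -[leRHS](powRr0 N) ler_powR//; lra.
apply: le_trans (HC' (kolm_sol (M N)) (kolm_coef (M N)) (fun=> 1%:M) _ _ _ _ _ _ _ _) _.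
- exact: smooth_kolm_sol.
- by move=> p _; rewrite mul1mx -laplace_v_trace; exact: kolm_sol_equation.
- move=> p _; split; apply: qform; last exact: ltW.
  by rewrite invf_le1// ltW.
- by move=> p _; rewrite (le_trans (kolm_coef_le p MN))//; lra.
- split.
    exists (3 / 2) => p _; have /andP[u1 u2] := kolm_sol_bounds p MN.
    by rewrite ger0_norm//; lra.
  apply: le_lt_trans (ltry _); apply: holder_v_le => *.
  exact: kolm_sol_holder.
- split; first by eexists => p _; exact: hess_kolm_sol_le.
  apply: le_lt_trans (ltry _); apply: holder_v_le => *.
  exact: hess_kolm_sol_holder.
- split; first by exists (frob (1%:M : 'M[R]_d.+1)).
  by rewrite holder_v_cst ?frob0// => y; exact: frob_ge0.
- split; first by exists 2 => p _; exact: kolm_coef_le.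
  exact: le_lt_trans coefH1 (ltry _).
rewrite holder_v_cst ?frob0//; last by move=> y; exact: frob_ge0.
rewrite poweR0r; last by rewrite gt_eqF// addr_gt0// divr_gt0.
rewrite adde0.
have supu : (sup_norm Q1 (@kolm_sol R d (M N)) <= (3 / 2)%:E)%E.
  apply: ge_ereal_sup => _ [p _ <-]; rewrite lee_fin.
  by have /andP[u1 u2] := kolm_sol_bounds p MN; rewrite ger0_norm//; lra.
have supu0 : (0 <= sup_norm Q1 (@kolm_sol R d (M N)))%E.
  apply: (@le_trans _ _ `|kolm_sol (M N) (0 : phase R d.+1)|%:E) => //.
  by apply: ereal_sup_ubound; exists 0 => //; exact: cylinder_origin.
have coefH0 := holder_v_ge0 alpha (@kolm_coef R d (M N)) (@normr_ge0 _ _).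
set H := holder_v _ _ _ in coefH0 coefH1 *.
have H0 : (0 <= 1 + H)%E by rewrite adde_ge0.
apply: (@le_trans _ _ (`|C'|%:E * (1 + H) * sup_norm Q1 (@kolm_sol R d (M N)))%E).
  by apply: lee_wpmul2r => //; apply: lee_wpmul2r => //; rewrite lee_fin ler_norm.
rewrite /K 2!EFinM; apply: lee_pmul => //; first by rewrite mule_ge0.
by apply: lee_wpmul2l => //; rewrite EFinD leeD.
Unshelve. all: by end_near. Qed.
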